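(* Let $K\subseteq\mathbb{R}^2$ be a convex body and let $\Lambda\subseteq\mathbb{R}^2$ be a $2$-dimensional lattice such that $\rho_2(K,\Lambda)\le\frac12$. Then $$\#(K\cap\Lambda)\ge\frac12\left\lfloor\frac{1}{\rho_1(K,\Lambda)}-2\right\rfloor\left(\frac{1}{\rho_2(K,\Lambda)}-2\right)-2.$$ If moreover $K$ is origin-symmetric (that is, $K=-K$), then $$\#(K\cap\Lambda)\ge\left\lfloor\frac{1}{2\rho_1(K,\Lambda)}\right\rfloor\left(\frac{1}{\rho_2(K,\Lambda)}-2\right).$$
   Context: A convex body in $\mathbb{R}^n$ is a compact convex set with non-empty interior. An $n$-dimensional lattice is a set $\Lambda=B\mathbb{Z}^n$ with $B\in\mathbb{R}^{n\times n}$ invertible. $\#$ denotes cardinality. $K_c=K-K=\{x-y:x,y\in K\}$ is the difference body. Packing minima: for $1\le i\le n$, $\rho_i(K,\Lambda)=\inf\{\rho>0:(\rho K_c+L)\cap\Lambda\neq L\cap\Lambda\text{ for all }(n-i)\text{-dimensional linear subspaces }L\subseteq\mathbb{R}^n\}$. Equivalently, $\rho_i(K,\Lambda)=\max\lambda_1(K_c|L^\perp,\Lambda|L^\perp)$, the maximum over all $(n-i)$-dimensional linear lattice planes $L$ of $\Lambda$ (linear subspaces $L$ with $\dim L=\dim(L\cap\Lambda)=n-i$), where $\cdot|L^\perp$ is orthogonal projection onto $L^\perp$ and, for an origin-symmetric convex body $M$ and a lattice $\Gamma$ in the same Euclidean space, $\lambda_1(M,\Gamma)=\min\{\lambda>0:\lambda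 M\cap\Gamma\ne\{0\}\}$. Here $n=2$. *)

(* Defs.v *)
From HB Require Import structures.
From mathcomp Require Import all_boot all_order all_algebra finmap.
From mathcomp Require Import all_classical all_reals all_analysis.

Set Implicit Arguments.
Unset Strict Implicit.
Unset Printing Implicit Defensive.

Import Order.TTheory GRing.Theory Num.Theory.
Import numFieldNormedType.Exports.
Local Open Scope classical_set_scope.
Local Open Scope ring_scope.

Section PackingMinima.
Variables (R : realType) (n : nat).
Implicit Types K Lam : set 'cV[R]_n.

(* The topology on ['cV[R]_n] is that of the sup norm, i.e. the usual one. *)
Definition convex_body K : Prop :=
  [/\ compact K, convex_set K & interior K !=set0].

Definition is_lattice Lam : Prop :=
  exists2 B : 'M[R]_n, B \in unitmx &
    Lam = range (fun z : 'cV[int]_n => B *m map_mx intr z).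

Definition difference_body K : set 'cV[R]_n := [set x - y | x in K & y in K].

Definition minkowski_sum (A B : set 'cV[R]_n) : set 'cV[R]_n :=
  [set x + y | x in A & y in B].

Definition dilate (r : R) (A : set 'cV[R]_n) : set 'cV[R]_n :=
  [set r *: x | x in A].

(* Meaningful for [1 <= i <= n]: [n - i] is the truncated subtraction. *)
Definition packing_min (i : nat) K Lam : R :=
  inf [set r : R | 0 < r /\
    forall L : {vspace 'cV[R]_n}, \dim L = (n - i)%N ->
      minkowski_sum (dilate r (difference_body K)) [set` L] `&` Lam
        <> [set` L] `&` Lam].

Definition origin_symmetric K : Prop := K = [set - x | x in K].

(* [fset_set] is the empty finite set on infinite sets; the intersection of a
   compact set with a lattice is always finite. *)
Definition lattice_points K Lam : nat := #|` fset_set (K `&` Lam)|.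

End PackingMinima.

(* Main.v *)
(* In a basis (v, u) of the lattice, [1 / rho_1] is at most the width of K in
   the u-coordinate, and by definition of [rho_2] one may choose v such that K
   contains a segment q, q + l v with l arbitrarily close to [1 / rho_2].  K then
   contains the convex hull of this segment and of two points of extremal
   u-coordinate, and the lattice points of that quadrilateral are counted row by
   row: a row of length s contains at least s - 1 of them.  In the symmetric case
   the quadrilateral is a parallelogram centred at the origin, and dropping the
   row next to each apex gives the better constant. *)
Require Import Defs.
From mathcomp Require Import all_boot all_order all_algebra finmap.
From mathcomp Require Import all_classical all_reals all_analysis.
From mathcomp Require Import ring lra zify.

Set Implicit Arguments.
Unset Strict Implicit.
Unset Printing Implicit Defensive.

Import Order.TTheory GRing.Theory Num.Theory.
Import numFieldNormedType.Exports.
Local Open Scope classical_set_scope.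
Local Open Scope ring_scope.

(** * Integer points in rows, and sums of row lengths *)

Lemma convex_set_mix (R : realType) (V : lmodType R) (K : set V) (x y : V)
    (t : R) : convex_set K -> K x -> K y -> 0 <= t <= 1 ->
  K ((1 - t) *: x + t *: y).
Proof.
move=> cK Kx Ky /andP[t0 t1].
have /(_ (Itv01 t0 t1)) := cK y x.
rewrite !inE => /(_ Ky Kx).
by rewrite /conv /= addrC.
Qed.

(** Row [j] contains the points with first index [Num.ceil (x j) + k] for [k < Num.trunc (s j)], and
    [Num.trunc (s j) > s j - 1]. Injectivity of [f] keeps all of them distinct. *)
Lemma sum_rows_le_card (R : realType) (T : choiceType) (S : set T)
    (f : int -> int -> T) (js : seq int) (x s : int -> R) :
  finite_set S -> (forall i j i' j', f i j = f i' j' -> i = i' /\ j = j') ->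
  uniq js ->
  (forall j, j \in js -> 0 <= s j /\
     forall i : int, x j <= i%:~R <= x j + s j -> S (f i j)) ->
  \sum_(j <- js) (s j - 1) <= #|` fset_set S|%:R.
Proof.
move=> finS f_inj js_uniq rowS.
pose l := [seq f (Num.ceil (x j) + k%:Z) j
          | j <- js, k <- iota 0 (Num.trunc (s j))].
have l_uniq : uniq l.
  apply: allpairs_uniq_dep => // [j _|]; first exact: iota_uniq.
  move=> [j k] [j' k'] _ _ /= /f_inj[] /[swap] <- eqk.
  by have [->] := addrI _ eqk.
have l_sub : {subset l <= fset_set S}.
  move=> _ /allpairsPdep[j [k [js_j + ->]]].
  rewrite mem_iota add0n /= in_fset_set// inE => kn.
  have [s_ge0 +] := rowS _ js_j; apply.
  have /andP[+ xc] := ceil_itv (x j); rewrite intrB => cx.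
  have /andP[ns _] := truncn_itv s_ge0.
  have : (k.+1)%:R <= (Num.trunc (s j))%:R :> R by rewrite ler_nat.
  rewrite intrD -pmulrn -natr1; have : 0 <= k%:R :> R by []; lra.
apply: (@le_trans _ _ (size l)%:R); last by rewrite ler_nat uniq_leq_size.
rewrite size_allpairs_dep sumnE big_map natr_sum big_seq [leRHS]big_seq.
apply: ler_sum => j /rowS[s_ge0 _]; rewrite size_iota.
have /andP[_] := truncn_itv s_ge0.
rewrite -natr1; lra.
Qed.

Lemma sum_nat_half (R : realFieldType) (m : nat) :
  \sum_(k < m) (k%:R : R) = 2^-1 * (m%:R * (m%:R - 1)).
Proof.
elim: m => [|m IH]; first by rewrite big_ord0 mul0r mulr0.
by rewrite big_ord_recr /= IH -natr1; field.
Qed.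

(* [l * (1 - (d + k) / h)] is the length of the row at distance [d + k] from the
   base [l] of a triangle of height [h].  If [h = 0] then the quotient is [0],
   which is the right value as the only possible row is the base. *)
Lemma half_tent_sum (R : realFieldType) (l h d : R) (m : nat) :
  0 <= l -> 0 <= d <= 1 -> 0 <= h ->
  (forall k, (k < m)%N -> d + k%:R <= h) ->
  2^-1 * (m%:R - 1) * (l - 2) - 1 <= \sum_(k < m) (l * (1 - (d + k%:R) / h) - 1).
Proof.
move=> l0 /andP[d0 d1] h0 dh.
have -> : \sum_(k < m) (l * (1 - (d + k%:R) / h) - 1) =
    m%:R * (l - 1) - l * ((m%:R * d + 2^-1 * (m%:R * (m%:R - 1))) / h).
  rewrite -sum_nat_half.
  transitivity (\sum_(k < m) ((l - 1 - l * (d / h)) - (l / h) * k%:R)).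
    by apply: eq_bigr => k _; ring.
  rewrite big_split /= sumr_const card_ord sumrN -mulr_sumr -mulr_natl; ring.
set q := _ / h.
(* With [(m + 1) / 2] in place of [q] the bound becomes an equality. For [m > 0] the last row gives
   [d + (m - 1) <= h], and what remains is [(m - 1) * d <= m - 1]. *)
suff q_le : q <= (m%:R + 1) / 2.
  have := ler_wpM2l l0 q_le; lra.
case: m dh @q => [|m] dh /=.
  by rewrite !mul0r mulr0 addr0 mul0r; lra.
have := dh m (ltnSn m); rewrite -natr1 => dmh.
have m0 : 0 <= m%:R :> R by [].
have [->|hn0] := eqVneq h 0; first by rewrite invr0 mulr0; lra.
have hp : 0 < h by rewrite lt_def hn0.
rewrite ler_pdivrMr//.
have m_md : m%:R * d <= m%:R by rewrite ler_piMr.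
have mdh : m%:R * (d + m%:R) <= m%:R * h by rewrite ler_wpM2l.
nra.
Qed.

(** The rows lose [l * (0 + ... + m) / h] in total, which is at most [l * m / 2] because
    [m + 1 <= h]. *)
Lemma central_tent_sum (R : realFieldType) (l h : R) (m : nat) :
  0 <= l -> m.+1%:R <= h ->
  m.+1%:R * (l - 1) - l * (2^-1 * m%:R) <=
    \sum_(k < m.+1) (l * (1 - k%:R / h) - 1).
Proof.
move=> l0 mh.
have h0 : 0 < h by apply: lt_le_trans mh; rewrite ltr0n.
have -> : \sum_(k < m.+1) (l * (1 - k%:R / h) - 1) =
    m.+1%:R * (l - 1) - l * (2^-1 * m%:R * (m.+1%:R / h)).
  transitivity (\sum_(k < m.+1) ((l - 1) - (l / h) * k%:R)).
    by apply: eq_bigr => k _; ring.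
  rewrite big_split /= sumr_const card_ord sumrN -mulr_sumr sum_nat_half.
  by rewrite -mulr_natl -natr1; ring.
rewrite lerD2l lerN2 ler_wpM2l// ler_piMr ?mulr_ge0 ?invr_ge0//.
by rewrite ler_pdivrMr// mul1r.
Qed.

(** At proportion [t] of the way from the base to the apex, the row is the base shrunk by [1 - t];
    each of its points mixes a base point with the apex. *)
Lemma convex_triangle_row (R : realType) (V : lmodType R) (K : set V) (v u : V)
    (q c l z b t i : R) :
  convex_set K -> K (q *: v + c *: u) -> K ((q + l) *: v + c *: u) ->
  K (z *: v + b *: u) -> 0 <= l -> 0 <= t <= 1 ->
  (1 - t) * q + t * z <= i <= (1 - t) * q + t * z + l * (1 - t) ->
  K (i *: v + (c + t * (b - c)) *: u).
Proof.
move=> cK Kq Kql Kz l0 t01 /andP[i_ge i_le].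
set s := i - ((1 - t) * q + t * z).
(* [r] locates the base point to be mixed with the apex. On a row of length [0] the quotient is [0],
   and so is [s]. *)
pose r := s / (l * (1 - t)).
have lt0 : 0 <= l * (1 - t) by rewrite mulr_ge0//; lra.
have rs : r * (l * (1 - t)) = s.
  rewrite /r; have [lt_eq0|lt_neq0] := eqVneq (l * (1 - t)) 0.
    by rewrite /s lt_eq0; lra.
  by rewrite divfK.
have r01 : 0 <= r <= 1.
  apply/andP; split; first by rewrite divr_ge0// /s; lra.
  have [lt_eq0|lt_neq0] := eqVneq (l * (1 - t)) 0.
    by rewrite /r lt_eq0 invr0 mulr0.
  by rewrite ler_pdivrMr ?lt_def ?lt_neq0// /s; lra.
have := convex_set_mix cK (convex_set_mix cK Kq Kql r01) Kz t01.
congr K; rewrite !scalerDr !scalerA.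
have -> : i = (1 - t) * q + t * z + r * (l * (1 - t)) by rewrite rs /s; ring.
have comb (a1 b1 a2 b2 : R) : (a1 *: v + b1 *: u) + (a2 *: v + b2 *: u) =
    (a1 + a2) *: v + (b1 + b2) *: u by rewrite addrACA -!scalerDl.
by rewrite !comb; congr (_ *: _ + _ *: _); ring.
Qed.

(** * Row counts for the quadrilateral and the centred parallelogram *)

Section RowCount.
Variables (R : realType) (V : lmodType R) (K S : set V) (v u : V).
Hypotheses (convK : convex_set K) (finS : finite_set S).
Hypothesis vu_free : forall i j i' j' : int,
  i%:~R *: v + j%:~R *: u = i'%:~R *: v + j'%:~R *: u -> i = i' /\ j = j'.
Hypothesis subKS :
  forall i j : int, K (i%:~R *: v + j%:~R *: u) -> S (i%:~R *: v + j%:~R *: u).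

(** The base at height [c] separates two triangles of heights [b - c] and [c - a]. In each,
    [half_tent_sum] costs one row and one point, whence both constants [2]. *)
Lemma card_ge_quadrilateral (q c l za a zb b : R) :
  K (q *: v + c *: u) -> K ((q + l) *: v + c *: u) ->
  K (za *: v + a *: u) -> K (zb *: v + b *: u) ->
  a <= c <= b -> 2 <= l ->
  2^-1 * ((Num.floor (b - a))%:~R - 2) * (l - 2) - 2 <= #|` fset_set S|%:R.
Proof.
move=> Kq Kql Ka Kb /andP[ac cb] l2.
have l0 : 0 <= l by lra.
have [fb /andP[fb1]] : exists z : int, z%:~R <= b < (z + 1)%:~R.
  by exists (Num.floor b); exact: floor_itv.
have [cc /andP[+ cc2]] : exists z : int, (z - 1)%:~R < c <= z%:~R.
  by exists (Num.ceil c); exact: ceil_itv.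
have [ca /andP[+ ca2]] : exists z : int, (z - 1)%:~R < a <= z%:~R.
  by exists (Num.ceil a); exact: ceil_itv.
rewrite !(intrD, intrN) => ca1 cc1 fb2.
(* [m1] rows have height in [[c, b]] and [m2] in [[a, c)], so a row at height [c] is counted
   once. *)
have [m1 m1E] : exists m : nat, m%:Z = fb - cc + 1.
  exists `|(fb - cc + 1)%R|%N; apply: gez0_abs.
  suff : -2 < fb - cc by clear; lia.
  by rewrite -(ltr_int R) !(intrD, intrN); lra.
have [m2 m2E] : exists m : nat, m%:Z = cc - ca.
  exists `|(cc - ca)%R|%N; apply: gez0_abs.
  suff : -1 < cc - ca by clear; lia.
  by rewrite -(ltr_int R) !(intrD, intrN); lra.
pose up (k : nat) : int := cc + k%:Z.
pose dn (k : nat) : int := cc - 1 - k%:Z.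
(* [t j] is the position of row [j] between the base and the apex on its side. If [b = c] the first
   quotient is [0], as it should be on the base. *)
pose t (j : int) : R :=
  if c <= j%:~R then (j%:~R - c) / (b - c) else (c - j%:~R) / (c - a).
pose z (j : int) : R := if c <= j%:~R then zb else za.
have upc k : c <= (up k)%:~R.
  by rewrite intrD -pmulrn; have : 0 <= k%:R :> R by []; lra.
have dnc k : (dn k)%:~R < c.
  by rewrite !(intrD, intrN) -pmulrn; have : 0 <= k%:R :> R by []; lra.
have up_le k : (k < m1)%N -> (up k)%:~R <= b.
  move=> km; apply: le_trans fb1; rewrite ler_int /up; move: km m1E; clear; lia.
have dn_ge k : (k < m2)%N -> a <= (dn k)%:~R.
  move=> km; apply: (le_trans ca2); rewrite ler_int /dn; move: km m2E; clear; lia.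
pose js := [seq up k | k <- index_iota 0 m1] ++ [seq dn k | k <- index_iota 0 m2].
have js_uniq : uniq js.
  rewrite cat_uniq !map_inj_uniq ?iota_uniq /=; last 2 first.
  - by move=> k k'; rewrite /dn; clear; lia.
  - by move=> k k'; rewrite /up; clear; lia.
  rewrite andbT; apply/hasPn => _ /mapP[k _ ->]; apply/mapP => -[k' _ ].
  by rewrite /up /dn; clear; lia.
have row (j : int) : j \in js -> 0 <= l * (1 - t j) /\
    forall i : int, (1 - t j) * q + t j * z j <= i%:~R <=
      (1 - t j) * q + t j * z j + l * (1 - t j) ->
    S (i%:~R *: v + j%:~R *: u).
  move=> js_j.
  suff [w [Kw t01 jE]] : exists w, [/\ K (z j *: v + w *: u), 0 <= t j <= 1 &
      j%:~R = c + t j * (w - c)].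
    split=> [|i]; first by rewrite mulr_ge0//; lra.
    by move=> hi; apply: subKS; rewrite jE; exact: convex_triangle_row hi.
  rewrite /t /z; move: js_j; rewrite mem_cat => /orP[] /mapP[k].
    rewrite mem_index_iota => /= /up_le + -> => k_b; rewrite upc.
    exists b; split => //; move: (upc k) => k_c.
      have [bc0|bc0] := eqVneq (b - c) 0; first by rewrite bc0 invr0 mulr0; lra.
      have bcp : 0 < b - c by lra.
      by rewrite divr_ge0 ?ler_pdivrMr//=; lra.
    have [bc0|bc0] := eqVneq (b - c) 0; first by rewrite bc0; lra.
    by rewrite divfK//; ring.
  rewrite mem_index_iota => /= /dn_ge + -> => k_a; rewrite leNgt dnc /=.
  exists a; split => //; move: (dnc k) => k_c.
    have cap : 0 < c - a by lra.
    by rewrite divr_ge0 ?ler_pdivrMr//=; lra.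
  have cap : c - a != 0 by lra.
  by rewrite -(opprB c a) mulrN divfK//; ring.
apply: le_trans (sum_rows_le_card finS vu_free js_uniq row).
rewrite big_cat !big_map !big_mkord /=.
have cd1 : 0 <= cc%:~R - c <= 1 by lra.
have cd2 : 0 <= c - cc%:~R + 1 <= 1 by lra.
have bc0 : 0 <= b - c by lra.
have ca0 : 0 <= c - a by lra.
have -> : \sum_(k < m1) (l * (1 - t (up k)) - 1) =
    \sum_(k < m1) (l * (1 - (cc%:~R - c + k%:R) / (b - c)) - 1).
  apply: eq_bigr => k _; rewrite /t upc intrD -pmulrn.
  by congr (_ * (1 - _ / _) - _); ring.
have -> : \sum_(k < m2) (l * (1 - t (dn k)) - 1) =
    \sum_(k < m2) (l * (1 - (c - cc%:~R + 1 + k%:R) / (c - a)) - 1).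
  apply: eq_bigr => k _; rewrite /t leNgt dnc /= !(intrD, intrN) -pmulrn.
  by congr (_ * (1 - _ / _) - _); ring.
have le1 := half_tent_sum (m := m1) l0 cd1 bc0.
have le2 := half_tent_sum (m := m2) l0 cd2 ca0.
have /le1 {}le1 k : (k < m1)%N -> cc%:~R - c + k%:R <= b - c.
  by move/up_le; rewrite !(intrD, intrN) -pmulrn; lra.
have /le2 {}le2 k : (k < m2)%N -> c - cc%:~R + 1 + k%:R <= c - a.
  by move/dn_ge; rewrite !(intrD, intrN) -pmulrn; lra.
(* [m1 + m2] is the number of integers in [[a, b]]. *)
have floor_le : (Num.floor (b - a))%:~R <= m1%:R + m2%:R :> R.
  have -> : m1%:R + m2%:R = (m1%:Z + m2%:Z)%:~R :> R by rewrite intrD -!pmulrn.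
  rewrite m1E m2E ler_int.
  suff : Num.floor (b - a) < fb - ca + 2 by clear; lia.
  have /andP[fba _] := floor_itv (b - a).
  by rewrite -(ltr_int R) !(intrD, intrN); lra.
have : 0 <= (m1%:R + m2%:R - (Num.floor (b - a))%:~R) * (l - 2).
  by rewrite mulr_ge0//; lra.
lra.
Qed.

(** Only the rows from [-m] to [m] are counted. By symmetry their sum is twice the bound of
    [central_tent_sum] minus the base row: [2 * ((m + 1) * (l - 1) - l * m / 2) - (l - 1) = (m + 1)
    * (l - 2) + 1]. *)
Lemma card_ge_rhombus (l z b : R) (m : nat) :
  K (- (l / 2) *: v) -> K ((l / 2) *: v) ->
  K (z *: v + b *: u) -> K (- (z *: v + b *: u)) ->
  m.+1%:R <= b -> 0 <= l ->
  m.+1%:R * (l - 2) + 1 <= #|` fset_set S|%:R.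
Proof.
move=> Klm Klp Kb Kbm mb l0.
have b0 : 0 < b by apply: lt_le_trans mb; rewrite ltr0n.
pose up (k : nat) : int := k%:Z.
pose dn (k : nat) : int := - k.+1%:Z.
pose t (j : int) : R := `|j%:~R| / b.
(* The sign [e j] selects the apex: rows below [0] lie under its reflection in the origin. *)
pose e (j : int) : R := if 0 <= j then 1 else -1.
have t_up k : t (up k) = k%:R / b by rewrite /t /up -pmulrn normr_nat.
have t_dn k : t (dn k) = k.+1%:R / b.
  by rewrite /t /dn intrN normrN -pmulrn normr_nat.
pose js := [seq up k | k <- index_iota 0 m.+1] ++ [seq dn k | k <- index_iota 0 m].
have js_uniq : uniq js.
  rewrite cat_uniq !map_inj_uniq ?iota_uniq; last 2 first.
  - by move=> k k'; rewrite /dn; clear; lia.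
  - by move=> k k'; rewrite /up; clear; lia.
  rewrite andbT; apply/hasPn => _ /mapP[k _ ->]; apply/mapP => -[k' _].
  by rewrite /up /dn; clear; lia.
have row (j : int) : j \in js -> 0 <= l * (1 - t j) /\
    forall i : int,
      (1 - t j) * - (l / 2) + t j * (e j * z) <= i%:~R <=
      (1 - t j) * - (l / 2) + t j * (e j * z) + l * (1 - t j) ->
    S (i%:~R *: v + j%:~R *: u).
  move=> js_j.
  have t01 : 0 <= t j <= 1.
    rewrite divr_ge0 ?(ltW b0)//= ler_pdivrMr// mul1r; apply: le_trans mb.
    rewrite -intr_norm pmulrn ler_int.
    move: js_j; rewrite mem_cat => /orP[] /mapP[k]; rewrite mem_index_iota.
      by rewrite /up => /[swap] ->; clear; lia.
    by rewrite /dn => /[swap] ->; clear; lia.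
  split=> [|i hi]; first by rewrite mulr_ge0//; lra.
  apply: subKS.
  have -> : j%:~R = 0 + t j * (e j * b - 0) :> R.
    rewrite add0r subr0 mulrCA divfK ?gt_eqF// /e; case: (leP 0 j) => j0.
      by rewrite mul1r ger0_norm// ler0z.
    by rewrite mulN1r ltr0_norm ?ltrz0// opprK.
  apply: convex_triangle_row hi => //.
  - by rewrite scale0r addr0.
  - by rewrite scale0r addr0; congr K: Klp; congr (_ *: _); field.
  - rewrite -!scalerA -scalerDr /e; case: ifP => _; first by rewrite scale1r.
    by rewrite scaleN1r.
apply: le_trans (sum_rows_le_card finS vu_free js_uniq row).
rewrite big_cat !big_map !big_mkord /=.
have -> : \sum_(k < m.+1) (l * (1 - t (up k)) - 1) =
  \sum_(k < m.+1) (l * (1 - k%:R / b) - 1).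
  by apply: eq_bigr => k _; rewrite t_up.
have -> : \sum_(k < m) (l * (1 - t (dn k)) - 1) =
    \sum_(k < m.+1) (l * (1 - k%:R / b) - 1) - (l - 1).
  rewrite big_ord_recl mul0r subr0 mulr1 addrAC subrr add0r.
  by apply: eq_bigr => k _; rewrite t_dn.
have := central_tent_sum l0 mb; rewrite -natr1; lra.
Qed.
End RowCount.

(** * Lattice coordinates, finiteness, and bases adapted to a lattice vector *)

Section Lattice.
Variable R : realType.
Implicit Types (K Lam : set 'cV[R]_2) (B : 'M[R]_2).

Definition lattice_of B : set 'cV[R]_2 :=
  range (fun z : 'cV[int]_2 => B *m map_mx intr z).

Lemma cvE (A : pzRingType) (x y : 'cV[A]_2) :
  x 0 0 = y 0 0 -> x 1 0 = y 1 0 -> x = y.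
Proof.
move=> e0 e1; apply/matrixP => i j; rewrite (ord1 j).
by case: i => [[|[|//]]] ?;
  [move: e0|move: e1]; congr (x _ _ = y _ _); exact: val_inj.
Qed.

Lemma mul_cvE (A : comPzRingType) (B : 'M[A]_2) (x : 'cV[A]_2) :
  B *m x = x 0 0 *: col 0 B + x 1 0 *: col 1 B.
Proof.
by apply/matrixP => i j; rewrite (ord1 j) !mxE !big_ord_recl big_ord0 addr0
  (_ : lift 0 0 = 1) 1?mulrC 1?[B _ 1 * _]mulrC//; exact: val_inj.
Qed.

Lemma continuous_mul_coord B (i : 'I_2) :
  continuous (fun x : 'cV[R]_2 => (B *m x) i 0).
Proof.
have -> : (fun y : 'cV[R]_2 => (B *m y) i 0) =
  (fun y : 'cV[R]_2 => B i 0 * y 0 0 + B i 1 * y 1 0).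
  apply/funext => y; rewrite mxE !big_ord_recl big_ord0 addr0.
  by rewrite (_ : lift 0 0 = 1)//; exact: val_inj.
move=> x.
have ct (a : R) (k : 'I_2) : {for x, continuous (fun y : 'cV[R]_2 => a * y k 0)}.
  apply: (@continuousM R 'cV[R]_2 (fun=> a) (fun y => y k 0)).
    exact: cst_continuous.
  exact: coord_continuous.
exact: (@continuousD R R 'cV[R]_2 _ _ x (ct _ _) (ct _ _)).
Qed.

Lemma coord_extrema K B (i : 'I_2) : compact K -> K !=set0 ->
  exists p q, [/\ K p, K q &
    forall x, K x -> (B *m p) i 0 <= (B *m x) i 0 <= (B *m q) i 0].
Proof.
move=> cK K0.
have ct : {within K, continuous (fun x : 'cV[R]_2 => (B *m x) i 0)}.
  by apply: continuous_subspaceT => x; exact: continuous_mul_coord.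
have [p + pmin] := compact_EVT_min K0 cK ct.
have [q + qmax] := compact_EVT_max K0 cK ct.
rewrite !inE => Kq Kp; exists p, q; split => // x Kx.
by rewrite pmin ?qmax ?inE.
Qed.

(** Compactness bounds both coordinates in the basis [B], which leaves finitely many integer
    pairs. *)
Lemma finite_body_lattice K B : B \in unitmx -> compact K ->
  finite_set (K `&` lattice_of B).
Proof.
move=> uB cK.
have [->|K0] := eqVneq K set0; first by rewrite set0I.
move/set0P : K0 => K0.
have bnd (i : 'I_2) : exists N : nat,
    forall x, K x -> `|(invmx B *m x) i 0| < N%:R.
  have [p [q [_ _ pq]]] := coord_extrema (invmx B) i cK K0.
  set a := (invmx B *m p) i 0 in pq; set b := (invmx B *m q) i 0 in pq.
  exists (Num.trunc (`|a| + `|b|)).+1 => x /pq/andP[ax xb].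
  have /andP[_] := truncn_itv (addr_ge0 (normr_ge0 a) (normr_ge0 b)).
  apply: le_lt_trans.
  rewrite ler_norml.
  have := ler_norm b; have := ler_norm (- a); rewrite normrN.
  have := normr_ge0 a; have := normr_ge0 b; lra.
have [N0 b0] := bnd 0; have [N1 b1] := bnd 1.
pose rg (N : nat) : seq int := [seq (k%:Z - N%:Z) | k <- iota 0 (N.*2)].
have rgP N (z : int) : `|z%:~R : R| < N%:R -> z \in rg N.
  rewrite -intr_norm pmulrn ltr_int => zN.
  apply/mapP; exists `|(z + N%:Z)%R|%N.
    by rewrite mem_iota -addnn; move: zN; clear; lia.
  by move: zN; clear; lia.
pose g (ij : int * int) : 'cV[R]_2 := ij.1%:~R *: col 0 B + ij.2%:~R *: col 1 B.
apply: (sub_finite_set _ (finite_image g (finite_seq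
  [seq (i, j) | i <- rg N0, j <- rg N1]))).
move=> x [Kx [z _ zx]]; exists (z 0 0, z 1 0); last first.
  by rewrite /g /= -zx mul_cvE !mxE.
have zE : invmx B *m x = map_mx intr z by rewrite -zx mulKmx.
apply/allpairsP; exists (z 0 0, z 1 0); split => //=; apply: rgP.
  by have := b0 _ Kx; rewrite zE mxE.
by have := b1 _ Kx; rewrite zE mxE.
Qed.

(** Dividing the coordinates of [x] by their gcd [k] gives a primitive vector, which Bezout
    coefficients complete to an integer matrix [U] of determinant [1]; the columns of [B U] span the
    same lattice. *)
Lemma lattice_basis_along Lam x : is_lattice Lam -> Lam x -> x <> 0 ->
  exists B, [/\ B \in unitmx, Lam = lattice_of B &
    exists2 k : nat, (0 < k)%N & x = k%:R *: col 0 B].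
Proof.
move=> [B uB LamE]; rewrite LamE => -[z _ zx] x0.
set p := z 0 0; set q := z 1 0.
have g0 : gcdz p q != 0.
  apply/negP; rewrite gcdz_eq0 => /andP[/eqP p0 /eqP q0].
  by apply: x0; rewrite -zx mul_cvE !mxE -/p -/q p0 q0 !scale0r addr0.
have [a [b ab]] := Bezoutz p q.
set g := gcdz p q in g0 ab.
have [p' pE] : exists p', p = p' * g by exists (p %/ g)%Z; rewrite divzK// dvdz_gcdl.
have [q' qE] : exists q', q = q' * g by exists (q %/ g)%Z; rewrite divzK// dvdz_gcdr.
have ab1 : a * p' + b * q' = 1.
  by apply: (mulIf g0); rewrite mul1r -{}[RHS]ab pE qE; ring.
pose U : 'M[int]_2 := \matrix_(i, j)
  if i == 0 then (if j == 0 then p' else - b) else (if j == 0 then q' else a).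
have detU : \det U = 1.
  rewrite (expand_det_row _ 0) !big_ord_recl big_ord0 /cofactor !det_mx11 !mxE /=.
  by apply: etrans ab1; rewrite /bump /=; ring.
have uU : U \in unitmx by rewrite unitmxE detU unitr1.
pose UR : 'M[R]_2 := map_mx intr U.
have uUR : UR \in unitmx by rewrite unitmxE det_map_mx detU unitr1.
exists (B *m UR); split; first by rewrite unitmx_mul uB.
- apply/seteqP; split=> _ [w _ <-].
    exists (invmx U *m w) => //.
    by rewrite -mulmxA -map_mxM mulKVmx.
  by exists (U *m w) => //; rewrite map_mxM mulmxA.
- exists `|g|%N; first by rewrite absz_gt0.
  have gE : `|g|%:Z = g by exact: gez0_abs.
  rewrite -zx.
  have -> : z = g *: col 0 U.
    by apply: cvE; rewrite !mxE /= mulrC -?pE -?qE.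
  by rewrite !colE map_mxZ map_mxM map_delta_mx -scalemxAr mulmxA pmulrn gE.
Qed.
End Lattice.

(** * Bounds on the packing minima, and the count for a given chord *)

Section PackingBounds.
Variable R : realType.
Implicit Types (K Lam : set 'cV[R]_2) (B : 'M[R]_2).

(* If no [r] is admissible in the definition of [rho_1] then the infimum is [0], and
   so is its inverse: irrational lines [L] need not be considered. *)
Lemma packing_min1_le K B (W : R) : B \in unitmx -> K !=set0 ->
  (forall x y, K x -> K y -> (invmx B *m (x - y)) 1 0 <= W) ->
  1 / packing_min 1 K (lattice_of B) <= W.
Proof.
move=> uB [p0 Kp0] KW.
have W0 : 0 <= W by have := KW _ _ Kp0 Kp0; rewrite subrr mulmx0 mxE.
rewrite /packing_min; set S := [set r | _].
have [->|S0] := eqVneq S set0; first by rewrite inf0 invr0 mulr0.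
have col_unit (i : 'I_2) : invmx B *m col i B = delta_mx i 0.
  by rewrite colE mulKmx.
(* The test line is spanned by [col 0 B]. If [r * W < 1], a lattice point of [r K_c + L] has an
   integer second coordinate of absolute value below [1], hence lies in [L]. *)
have S_ge r : S r -> 1 <= r * W.
  pose v := col 0 B; move=> [r0 /(_ <[v]>%VS)] neq.
  rewrite leNgt; apply/negP => rW; apply: neq.
    rewrite dim_vline; case: eqP => // v0.
    have /matrixP/(_ 0 0) := col_unit 0.
    by rewrite -/v v0 mulmx0 !mxE /= => /eqP; rewrite eq_sym oner_eq0.
  apply/seteqP; split=> x [Lx Bx]; split=> //; last first.
    exists 0; last by exists x; rewrite ?add0r.
    exists 0; last by rewrite scaler0.
    by exists p0 => //; exists p0; rewrite ?subrr.
  move: Lx => [_ [_ [p Kp [q Kq <-]] <-] [y Ly xE]].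
  have [z _ zx] := Bx; have /vlineP[c yE] := Ly.
  have zE : z 1 0 = 0.
    have : (invmx B *m x) 1 0 = r * (invmx B *m (p - q)) 1 0.
      rewrite -xE yE mulmxDr -!scalemxAr col_unit 3!mxE [X in _ + X]mxE /=.
      by rewrite [X in c * X]mxE /= mulr0 addr0.
    rewrite -zx mulKmx// mxE => zr.
    have : `|(z 1 0)%:~R : R| < 1.
      (* [KW] bounds from above only; exchanging [p] and [q] bounds from below. *)
      have lepq := ler_wpM2l (ltW r0) (KW _ _ Kp Kq).
      have leqp := ler_wpM2l (ltW r0) (KW _ _ Kq Kp).
      rewrite -[q - p]opprB mulmxN mxE mulrN in leqp.
      by rewrite zr ltr_norml; lra.
    by rewrite -intr_norm ltrz1; clear; lia.
  apply/vlineP; exists (z 0 0)%:~R.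
  by rewrite -zx mul_cvE !mxE zE scale0r addr0.
move/set0P : S0 => S0; have [r1 Sr1] := S0.
have W_gt0 : 0 < W.
  rewrite lt_def W0 andbT; apply/eqP => W_eq0.
  by have := S_ge _ Sr1; rewrite W_eq0 mulr0 ler10.
have : W^-1 <= inf S.
  by apply: lb_le_inf => // r /S_ge; rewrite -[W^-1]mul1r ler_pdivrMr.
move=> W_inf; have infS0 : 0 < inf S by apply: lt_le_trans W_inf; rewrite invr_gt0.
by rewrite mul1r -[W]invrK lef_pV2 // posrE ?invr_gt0.
Qed.

Lemma packing_min_ge0 n (i : nat) (K Lam : set 'cV[R]_n) : 0 <= packing_min i K Lam.
Proof.
rewrite /packing_min; set S := [set r | _].
have [->|/set0P S0] := eqVneq S set0; first by rewrite inf0.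
by apply: lb_le_inf => // r [/ltW].
Qed.

(** For [i = 2] the only [L] is [0], so an admissible [r] yields a nonzero lattice point in [r K_c].
    Positivity of the infimum excludes the empty set, whose infimum is [0] by convention. *)
Lemma packing_min2_witness K Lam (s : R) : K !=set0 ->
  0 < packing_min 2 K Lam < s ->
  exists2 r, 0 < r < s &
    exists x p q, [/\ Lam x, x <> 0, K p, K q & x = r *: (p - q)].
Proof.
move=> [p0 Kp0]; rewrite /packing_min; set S := [set r | _] => /andP[inf0 infs].
have S0 : S !=set0.
  by apply/set0P/eqP => S0; rewrite S0 inf0 ltxx in inf0.
have [r [r0 /(_ 0%VS)] + rs] := inf_lt S0 infs.
rewrite dimv0 => /(_ erefl) neq; exists r; first by rewrite r0 rs.
apply: contrapT => none; apply: neq; apply/seteqP; split=> x [Lx Lamx]; split=> //.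
  move: Lx => [_ [_ [p Kp [q Kq <-]] <-] [y /= + xE]].
  rewrite memv0 => /eqP y0; rewrite y0 addr0 in xE.
  rewrite /= memv0; apply/eqP; apply: contrapT => x0.
  by apply: none; exists x, p, q.
exists 0; last by exists x; rewrite ?add0r.
exists 0; last by rewrite scaler0.
by exists p0 => //; exists p0; rewrite ?subrr.
Qed.

(** In a basis whose first vector [v] satisfies [x = k v] with [k >= 1], the chord from [q] to [p]
    supplies the base, and points of extremal second coordinate supply the apexes. *)
Lemma lattice_points_ge K Lam (l : R) (x p q : 'cV[R]_2) :
  convex_body K -> is_lattice Lam -> 2 <= l ->
  Lam x -> x <> 0 -> K p -> K q -> p - q = l *: x ->
  2^-1 * (Num.floor (1 / packing_min 1 K Lam - 2))%:~R * (l - 2) - 2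
    <= (lattice_points K Lam)%:R /\
  (origin_symmetric K ->
   (Num.floor (1 / (2 * packing_min 1 K Lam)))%:~R * (l - 2)
    <= (lattice_points K Lam)%:R).
Proof.
move=> [compK convK _] hLam l2 Lamx x0 Kp Kq pq.
have [B [uB LamE [k k0 xE]]] := lattice_basis_along hLam Lamx x0.
have K0 : K !=set0 by exists p.
have finS : finite_set (K `&` Lam) by rewrite LamE; exact: finite_body_lattice.
have coordE y : (invmx B *m y) 0 0 *: col 0 B + (invmx B *m y) 1 0 *: col 1 B = y.
  by rewrite -mul_cvE mulKVmx.
have KQ y : K y ->
    K ((invmx B *m y) 0 0 *: col 0 B + (invmx B *m y) 1 0 *: col 1 B).
  by rewrite coordE.
pose c2 (i j : int) : 'cV[int]_2 := \col_m (if m == 0 then i else j).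
have c2E (i j : int) : B *m map_mx intr (c2 i j) =
    i%:~R *: col 0 B + j%:~R *: col 1 B.
  by rewrite mul_cvE !mxE.
have vu_free (i j i' j' : int) : i%:~R *: col 0 B + j%:~R *: col 1 B =
    i'%:~R *: col 0 B + j'%:~R *: col 1 B -> i = i' /\ j = j'.
  rewrite -!c2E => /(can_inj (mulKmx uB))/matrixP eqc.
  have := eqc 0 0; have := eqc 1 0; rewrite !mxE /=.
  by move=> /intr_inj -> /intr_inj ->.
have subKS (i j : int) : K (i%:~R *: col 0 B + j%:~R *: col 1 B) ->
    (K `&` Lam) (i%:~R *: col 0 B + j%:~R *: col 1 B).
  by move=> ?; split=> //; rewrite LamE; exists (c2 i j) => //; rewrite c2E.
have k_gt0 : 0 < k%:R :> R by rewrite ltr0n.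
(* The chord is [l * k] times [col 0 B], so the proportion [1 / k] of it is kept. *)
have Kl : K (q + l *: col 0 B).
  have k01 : 0 <= (k%:R^-1 : R) <= 1.
    by rewrite invr_ge0 ler0n /= invf_le1// ler1n.
  have := convex_set_mix convK Kq Kp k01; congr K.
  rewrite -[p](subrK q) pq xE !scalerDr !scalerA scalerBl scale1r.
  rewrite (_ : k%:R^-1 * (l * k%:R) = l); last by field; rewrite gt_eqF.
  by rewrite addrCA addrC subrK addrC.
have [ya [yb [Ka Kb ab]]] := coord_extrema (invmx B) 1 compK K0.
split.
  have W_le : 1 / packing_min 1 K Lam <= (invmx B *m yb) 1 0 - (invmx B *m ya) 1 0.
    rewrite LamE; apply: packing_min1_le => // y z Ky Kz.
    rewrite mulmxBr mxE [X in _ + X]mxE.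
    have /andP[_ ?] := ab y Ky; have /andP[? _] := ab z Kz.
    by rewrite lerB.
  have := card_ge_quadrilateral convK finS vu_free subKS (KQ _ Kq) _ (KQ _ Ka)
    (KQ _ Kb) (ab _ Kq) l2.
  rewrite -/(lattice_points K Lam); set W := _ - _ in W_le *.
  set N := (lattice_points K Lam)%:R.
  move=> H.
  have {}H : 2^-1 * ((Num.floor W)%:~R - 2) * (l - 2) - 2 <= N.
    by apply: H; rewrite scalerDl addrAC coordE.
  set F := Num.floor _.
  (* The integer shift by [2] passes through the floor and absorbs the two rows lost in the
     count. *)
  have FW : F + 2 <= Num.floor W.
    rewrite floor_ge_int intrD; apply: le_trans W_le.
    by have := floor_le (1 / packing_min 1 K Lam - 2); rewrite -/F; lra.
  rewrite -(ler_int R) intrD in FW.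
  have : 0 <= ((Num.floor W)%:~R - 2 - F%:~R) * (l - 2).
    by rewrite mulr_ge0//; lra.
  lra.
move=> symK.
have KN y : K y -> K (- y) by rewrite {2}symK => Ky; exists y.
set b := (invmx B *m yb) 1 0 in ab.
have b_max y : K y -> (invmx B *m y) 1 0 <= b by move=> /ab/andP[].
(* Here the minimal coordinate is [- b], so the width is at most [2 * b]. *)
have W_le : 1 / packing_min 1 K Lam <= 2 * b.
  rewrite LamE; apply: packing_min1_le => // y z Ky Kz.
  by rewrite mulmxDr mxE; have := b_max _ Ky; have := b_max _ (KN _ Kz); lra.
have [F_le0|F_gt0] := leP (Num.floor (1 / (2 * packing_min 1 K Lam))) 0.
  apply: le_trans (ler0n _ _); rewrite mulr_le0_ge0 ?lerz0//; lra.
have [m mE] : exists m : nat, Num.floor (1 / (2 * packing_min 1 K Lam)) = m.+1%:Z.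
  by case: (Num.floor _) F_gt0 => [[|m]|] // _; exists m.
rewrite mE -pmulrn.
have mb : m.+1%:R <= b.
  rewrite pmulrn -mE; apply: le_trans (floor_le _) _.
  by rewrite invfM; lra.
(* The midpoint of [- q] and [q + l v] is an endpoint of a chord centred at the origin. *)
have Kh : K ((l / 2) *: col 0 B).
  have half01 : 0 <= (2^-1 : R) <= 1 by lra.
  have := convex_set_mix convK (KN _ Kq) Kl half01; congr K.
  rewrite (_ : 1 - 2^-1 = 2^-1 :> R); last by field.
  by rewrite -scalerDr addKr scalerA mulrC.
have := card_ge_rhombus convK finS vu_free subKS (_ : K (- (l / 2) *: col 0 B)) Kh
  (KQ _ Kb) (_ : K (- _)) mb (_ : 0 <= l).
rewrite -/(lattice_points K Lam) => H.
have {}H : m.+1%:R * (l - 2) + 1 <= (lattice_points K Lam)%:R.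
  apply: H; last lra.
  - by rewrite scaleNr; exact: KN.
  - by apply: KN; exact: KQ.
lra.
Qed.
End PackingBounds.

(** * Passage to the limit in [l], and both inequalities *)

Unset Implicit Arguments.

Theorem theorem1p4 (R : realType) (K Lam : set 'cV[R]_2)
    (hK : convex_body K) (hLam : is_lattice Lam)
    (hrho : packing_min 2 K Lam <= 1 / 2) :
  (2^-1 * (Num.floor (1 / packing_min 1 K Lam - 2))%:~R
     * (1 / packing_min 2 K Lam - 2) - 2 <= (lattice_points K Lam)%:R)
  /\
  (origin_symmetric K ->
   (Num.floor (1 / (2 * packing_min 1 K Lam)))%:~R
     * (1 / packing_min 2 K Lam - 2) <= (lattice_points K Lam)%:R :> R).
Proof.
have K0 : K !=set0 by case: hK => _ _ [p /interior_subset]; exists p.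
set F := Num.floor (_ - 2); set G := Num.floor (1 / (2 * _)).
set N := (lattice_points K Lam)%:R.
have N0 : 0 <= N :> R by rewrite /N ler0n.
have rho1_ge0 := packing_min_ge0 1 K Lam.
have F_ge : -2 <= F%:~R :> R.
  by rewrite (_ : -2 = (-2)%:~R)// ler_int floor_ge_int rmorphN lerBrDr
    addNr divr_ge0.
have G_ge : 0 <= G%:~R :> R by rewrite ler0z floor_ge0 divr_ge0// mulr_ge0.
(* If [packing_min 2 K Lam] is [0], its inverse is [0] by convention, and the bounds read
   [- F - 2 <= N] and [- 2 * G <= N]; [F_ge] and [G_ge] settle them. *)
have [rho2_le0|rho2_gt0] := leP (packing_min 2 K Lam) 0.
  have -> : packing_min 2 K Lam = 0.
    by apply/eqP; rewrite eq_le rho2_le0 packing_min_ge0.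
  by rewrite invr0 mulr0 sub0r; split=> [|_]; lra.
have rho2_inv : 2 <= 1 / packing_min 2 K Lam.
  by rewrite ler_pdivlMr//; move: hrho; lra.
(* Working with [l] slightly below [1 / rho_2] avoids proving that the infimum
   defining [rho_2] is attained. *)
have approx t : 2 <= t < 1 / packing_min 2 K Lam -> exists2 l, t < l &
    2^-1 * F%:~R * (l - 2) - 2 <= N /\ (origin_symmetric K -> G%:~R * (l - 2) <= N).
  move=> /andP[t2 t_lt]; have t0 : 0 < t by lra.
  have rho2_t : 0 < packing_min 2 K Lam < t^-1.
    by rewrite rho2_gt0 /= -[X in X < _]invrK ltf_pV2 ?posrE ?invr_gt0//
      -[X in _ < X]mul1r.
  have [r /andP[r0 rt] [x [p [q [Lx x0 Kp Kq xE]]]]] :=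
    packing_min2_witness K0 rho2_t.
  have tr : t < r^-1 by rewrite -[t]invrK ltf_pV2 ?posrE ?invr_gt0.
  exists r^-1 => //; apply: (lattice_points_ge hK hLam _ Lx x0 Kp Kq); first lra.
  by rewrite xE scalerA mulVf ?gt_eqF// scale1r.
(* A violation would put [t = d / a + 2] below [1 / packing_min 2 K Lam], and the resulting [l > t]
   would give [a * (l - 2) > d]. *)
have limit (a d : R) : 0 <= a -> 0 <= d ->
    (forall t, 2 <= t < 1 / packing_min 2 K Lam ->
      exists2 l, t < l & a * (l - 2) <= d) ->
    a * (1 / packing_min 2 K Lam - 2) <= d.
  move=> a0 d0 ad; rewrite leNgt; apply/negP => d_lt.
  have a_gt0 : 0 < a.
    by rewrite lt_def a0 andbT; apply/eqP => a_eq0; rewrite a_eq0 mul0r in d_lt; lra.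
  have [|l] := ad (d / a + 2).
    by rewrite lerDr divr_ge0//= -ltrBrDr ltr_pdivrMr// mulrC.
  by rewrite -ltrBrDr ltr_pdivrMr// mulrC => /lt_geF ->.
split=> [|symK]; last first.
  by apply: limit => // t /approx[l tl [_ /(_ symK)]]; exists l.
(* [limit] asks for a nonnegative factor; when [F <= 0] the left-hand side is at most [-2]. *)
have [F_le0|F_gt0] := leP F 0.
  have F_le0R : F%:~R <= 0 :> R by rewrite lerz0.
  have : F%:~R * (1 / packing_min 2 K Lam - 2) <= 0 by rewrite mulr_le0_ge0//; lra.
  lra.
have F0 : 0 <= F%:~R :> R by rewrite ler0z ltW.
rewrite lerBlDr; apply: limit; [lra|lra|].
by move=> t /approx[l tl [le_N _]]; exists l => //; lra.
Qed.
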